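(* Let $f:\mathbb{R}^n\to\mathbb{R}$ be convex and $M$-smooth, let $f^\star=\min_{x\in\mathbb{R}^n} f(x)$ and $S=\operatorname{argmin}_{x\in\mathbb{R}^n} f(x)$, and assume $S\neq\emptyset$. Let $c>0$, $\rho\ge \frac{M}{c}$, and $\beta\in\left[\frac{c+2\sqrt{c}+2}{c+2\sqrt{c}+3},\,1\right)$. Then the accelerated proximal bundle method with parameters $\rho,\beta$ started at $x_0\in\mathbb{R}^n$ generates a sequence of iterates $\{x_k\}$ satisfying $$f(x_k)-f^\star\le \frac{2\rho\,\mathrm{dist}^2(x_0,S)}{k^2},\qquad \forall k\ge 1.$$ Moreover, for $\epsilon>0$, the total iteration count (including all inner-loop iterations of $\mathtt{ProxDescent}$) required to obtain an $\epsilon$-optimal solution, i.e. a point $x_k$ such that $f(x_k)-f^\star\le\epsilon$, is bounded by $$\frac{16(M+\rho)^3}{(1-\beta)^2\rho^3}\sqrt{\frac{2\rho\,\mathrm{dist}^2(x_0,S)}{\epsilon}}.$$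
   Context: $\|\cdot\|$ is the Euclidean norm and $\mathrm{dist}(x,S)=\inf_{s\in S}\|x-s\|$. A function $f:\mathbb{R}^n\to\mathbb{R}$ is $M$-smooth ($M>0$) if it is differentiable and $\|\nabla f(x)-\nabla f(y)\|\le M\|x-y\|$ for all $x,y\in\mathbb{R}^n$. For a convex function $h$, $\partial h(x)$ is the convex subdifferential. **Subroutine $\mathtt{ProxDescent}(y_k,\beta,\rho)$** (input $y_k\in\mathbb{R}^n$, $\beta\in(0,1)$, $\rho>0$). Set $z_1=y_k$. For $j=1,2,\dots$: choose any convex function $\tilde f_j:\mathbb{R}^n\to\mathbb{R}$ satisfying the three conditions (i) (lower approximation) $\tilde f_j(y)\le f(y)$ for all $y\in\mathbb{R}^n$; (ii) (subgradient) there exists $g_j\in\partial f(z_j)$ such that $\tilde f_j(y)\ge f(z_j)+\langle g_j,y-z_j\rangle$ for all $y\in\mathbb{R}^n$; (iii) (aggregation) if $j>1$, then $\tilde f_j(y)\ge \tilde f_{j-1}(z_j)+\langle s_j,y-z_j\rangle$ for all $y\in\mathbb{R}^n$, where $s_j=\rho(y_k-z_j)\in\partial\tilde f_{j-1}(z_j)$. Compute $z_{j+1}=\operatorname{argmin}_{y}\{\tilde f_j(y)+\frac{\rho}{2}\|y-y_k\|^2\}$. If $f(y_k)-f(z_{j+1})\ge\beta\,(f(y_k)-\tilde f_j(z_{j+1}))$, stop and return $z_{j+1}$; otherwise continue with $j+1$. Each value of $j$ is one (inner) iteration. **Accelerated proximal bundle method** (parameters $\rho>0$, $\beta\in(0,1)$,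 starting point $x_0\in\mathbb{R}^n$). Set $z_0=x_0$, $A_0=0$. For $k=0,1,2,\dots$: $a_k=\frac{1+\sqrt{1+4A_k}}{2}$; $A_{k+1}=A_k+a_k$; $y_k=\frac{A_k}{A_{k+1}}x_k+\frac{a_k}{A_{k+1}}z_k$; $x_{k+1}=\mathtt{ProxDescent}(y_k,\beta,\rho)$; $z_{k+1}=z_k-a_k(y_k-x_{k+1})$. (The outer sequence $z_k$ is distinct from the inner candidates $z_j$ of the subroutine.) The total iteration count is the total number of inner iterations performed over all calls to $\mathtt{ProxDescent}$. *)

(* Defs.v *)
From HB Require Import structures.
From mathcomp Require Import all_boot all_order all_algebra.
From mathcomp Require Import all_classical all_reals all_analysis.

Set Implicit Arguments.
Unset Strict Implicit.
Unset Printing Implicit Defensive.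

Import Order.TTheory GRing.Theory Num.Theory.
Import numFieldNormedType.Exports.

Local Open Scope classical_set_scope.
Local Open Scope ring_scope.

(* The library norm `|x| on 'rV[R]_n is the sup norm, so the Euclidean
   structure is defined explicitly. Differentiability does not depend on
   this choice, the two norms being equivalent. *)
Definition dot (R : realType) (n : nat) (u v : 'rV[R]_n) : R :=
  \sum_(i < n) u 0 i * v 0 i.

Definition enorm (R : realType) (n : nat) (u : 'rV[R]_n) : R :=
  Num.sqrt (dot u u).

Definition dist (R : realType) (n : nat) (x : 'rV[R]_n) (S : set 'rV[R]_n) : R :=
  inf [set enorm (x - s) | s in S].

Definition convex_fun (R : realType) (n : nat) (h : 'rV[R]_n -> R) : Prop :=
  convex_function setT h.

Definition subdiff (R : realType) (n : nat) (h : 'rV[R]_n -> R)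
    (x : 'rV[R]_n) : set 'rV[R]_n :=
  [set g | forall y, h x + dot g (y - x) <= h y].

Definition grad (R : realType) (n : nat) (f : 'rV[R]_n -> R)
    (x : 'rV[R]_n) : 'rV[R]_n :=
  \row_i 'd f x (delta_mx 0 i).

Definition smooth (R : realType) (n : nat) (M : R) (f : 'rV[R]_n -> R) : Prop :=
  (forall x, differentiable f x) /\
  (forall x y, enorm (grad f x - grad f y) <= M * enorm (x - y)).

Definition argmin (R : realType) (n : nat) (h : 'rV[R]_n -> R) : set 'rV[R]_n :=
  [set x | forall y, h x <= h y].

(* This is the minimum of [h] whenever [argmin h] is nonempty. *)
Definition minval (R : realType) (n : nat) (h : 'rV[R]_n -> R) : R :=
  inf (range h).

(* [Aseq k] is A_k and [aseq k] is a_k. *)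
Fixpoint Aseq (R : realType) (k : nat) : R :=
  if k is k'.+1 then
    Aseq R k' + (1 + Num.sqrt (1 + 4 * Aseq R k')) / 2
  else 0.

Definition aseq (R : realType) (k : nat) : R :=
  (1 + Num.sqrt (1 + 4 * Aseq R k)) / 2.

(* A state of the method between two inner iterations, inside the outer
   iteration [outer] = k (a call of ProxDescent is always in progress):
   [xk], [zk] are the outer iterates x_k, z_k; [cand] is the inner candidate
   z_j; [prev] is the model of the preceding inner iteration of the same call,
   so that [prev = None] exactly when j = 1. *)
Record state (R : realType) (n : nat) := State {
  outer : nat;
  xk : 'rV[R]_n;
  zk : 'rV[R]_n;
  cand : 'rV[R]_n;
  prev : option ('rV[R]_n -> R) }.

Definition center (R : realType) (n k : nat) (x z : 'rV[R]_n) : 'rV[R]_n :=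
  (Aseq R k / Aseq R k.+1) *: x + (aseq R k / Aseq R k.+1) *: z.

Definition yk (R : realType) (n : nat) (s : state R n) : 'rV[R]_n :=
  center (outer s) (xk s) (zk s).

Definition start (R : realType) (n k : nat) (x z : 'rV[R]_n) : state R n :=
  State k x z (center k x z) None.

(* In the last condition (aggregation), the vector s_j = rho (y_k - z_j)
   automatically belongs to the subdifferential of the previous model at z_j,
   by optimality of z_j, so this membership is not required. *)
Definition admissible (R : realType) (n : nat) (f : 'rV[R]_n -> R) (rho : R)
    (s : state R n) (m : 'rV[R]_n -> R) : Prop :=
  [/\ convex_fun m,
      (forall y, m y <= f y),
      (exists2 g, subdiff f (cand s) g &
         forall y, f (cand s) + dot g (y - cand s) <= m y) &
      (if prev s is Some m' then
         forall y, m' (cand s) + dot (rho *: (yk s - cand s)) (y - cand s)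
                   <= m y
       else True)].

Definition prox_objective (R : realType) (n : nat) (m : 'rV[R]_n -> R) (rho : R)
    (y : 'rV[R]_n) : 'rV[R]_n -> R :=
  fun w => m w + rho / 2 * enorm (w - y) ^+ 2.

Definition descent_test (R : realType) (n : nat) (f m : 'rV[R]_n -> R) (beta : R)
    (y w : 'rV[R]_n) : bool :=
  beta * (f y - m w) <= f y - f w.

(* One inner iteration, with model [m] and computed point [w] = z_{j+1}.
   When the test succeeds, [w] is returned as x_{k+1} and the call for the next
   outer iteration is set up, at no cost in the iteration count. *)
Inductive step (R : realType) (n : nat) (f : 'rV[R]_n -> R) (rho beta : R)
    (s : state R n) : state R n -> Prop :=
| NullStep (m : 'rV[R]_n -> R) (w : 'rV[R]_n) :
    admissible f rho s m ->
    argmin (prox_objective m rho (yk s)) w ->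
    ~~ descent_test f m beta (yk s) w ->
    step f rho beta s (State (outer s) (xk s) (zk s) w (Some m))
| DescentStep (m : 'rV[R]_n -> R) (w : 'rV[R]_n) :
    admissible f rho s m ->
    argmin (prox_objective m rho (yk s)) w ->
    descent_test f m beta (yk s) w ->
    step f rho beta s
      (start (outer s).+1 w (zk s - aseq R (outer s) *: (yk s - w))).

(* An execution of the method from x_0: [r t] is the state reached after [t]
   inner iterations in total, over all calls of ProxDescent. *)
Definition execution (R : realType) (n : nat) (f : 'rV[R]_n -> R) (rho beta : R)
    (x0 : 'rV[R]_n) (r : nat -> state R n) : Prop :=
  r 0%N = start 0 x0 x0 /\ forall t, step f rho beta (r t) (r t.+1).

(* Main.v *)
Require Import Defs.
From HB Require Import structures.
From mathcomp Require Import all_boot all_order all_algebra.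
From mathcomp Require Import all_classical all_reals all_analysis.
From mathcomp Require Import ring lra.

Set Implicit Arguments.
Unset Strict Implicit.
Unset Printing Implicit Defensive.

Import Order.TTheory GRing.Theory Num.Theory.
Import numFieldNormedType.Exports.

Local Open Scope classical_set_scope.
Local Open Scope ring_scope.

(** The proof has two independent halves, the outer energy estimate and the
    count of inner steps; both use smoothness only through the quadratic upper
    bound [f u <= f x + <g, u - x> + M/2 |u - x|^2], for [g] a subgradient of
    [f] at [x] ([subdiff_upper]).

    Outer half. A proximal point [w] of a convex model [m <= f] with center [y]
    has [rho (y - w)] as a subgradient of [m] ([prox_subdiff]), so this vector
    is an [eps]-subgradient of [f] at [w], with [eps = f w - m w]. The
    accelerated method tolerates this error as long as [eps <= rho/2 |y - w|^2]:
    then [A_k (f x_k - f u) + rho/2 |z_k - u|^2] does not increase from one outer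
    iteration to the next ([energy_step], [energy_le]). That bound on [eps] is
    what the descent test gives when [beta] is close enough to 1
    ([descent_error]): the distance between the slope [rho (y - w)] and a
    subgradient of [f] at [w] is at most [sqrt (2 M eps)] ([slope_gap]), and the
    threshold on [beta] is the value at which the resulting upper bound on
    [f y - f w] contradicts a larger [eps]. Since [a_k^2 = A_{k+1}] forces
    [A_k >= k^2 / 4], the rate follows ([rate]).

    Inner half. Let [p] be the minimum of the model plus the proximal term, and
    [g] a subgradient at the center [y]. After any step [f y - p] is at least
    [|g|^2 / (2 (M + rho))] ([prox_value_le]), and after the first one it is at
    most [|g|^2 / (2 rho)] ([prox_value_ge]). When the test fails, the gap
    [f w - m w] is at least [(1 - beta) (f y - p)] ([null_gap]), and the next
    model, which lies above both the cut at [w] and the aggregate of the old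
    model, has a value [p] larger by a fixed fraction of that gap ([prox_gain]):
    the slopes of these two affine minorants differ by at most the square root
    of [2 M] times the gap, so the proximal term keeps a weighted average of
    them from descending much below its value at [w].
    Hence the number of null steps in a call is bounded by
    [4 M (M + rho) / (rho^2 (1 - beta))] plus one ([after_nulls_bound]).

    Combining the halves, [k > sqrt (2 rho dist^2 / eps)] outer iterations
    suffice. Rounding up to an integer is harmless: if that square root is
    small, then either [x0] is already [eps]-optimal or [M / rho] is large and
    the cubed constant absorbs the loss ([count_bound]). *)

(** * Euclidean geometry *)

(** Linear arithmetic compares its atoms up to conversion, which for inner
    products and function values at matrix expressions unfolds the matrix
    operations and is intractable; they become variables first. The hypotheses
    come back under fresh names because [lra] skips section hypotheses. *)
Ltac gen_reals :=
  repeat match goal with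
  | H : is_true (@Order.le _ _ _ _) |- _ => revert H
  | H : is_true (@Order.lt _ _ _ _) |- _ => revert H
  | H : @eq _ _ _ |- _ =>
      match type of H with context [@dot _ _ _ _] => revert H end
  end;
  repeat match goal with
  | |- context [@dot ?R ?n ?u ?v] => generalize (@dot R n u v); intro
  | |- context [?h ?u] =>
      is_var h; match type of u with matrix _ _ _ => idtac | _ => fail 1 end;
      generalize (h u); intro
  end;
  repeat match goal with |- _ -> _ => let h := fresh in intro h end.
Ltac vlra := gen_reals; lra.
Ltac vnra := gen_reals; nra.

Section Dot.
Variables (R : realType) (n : nat).
Implicit Types u v w : 'rV[R]_n.

Lemma dotC u v : dot u v = dot v u.
Proof. by apply: eq_bigr => i _; rewrite mulrC. Qed.

Lemma dotDl u v w : dot (u + v) w = dot u w + dot v w.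
Proof. by rewrite -big_split; apply: eq_bigr => i _; rewrite mxE mulrDl. Qed.

Lemma dotZl (a : R) u v : dot (a *: u) v = a * dot u v.
Proof. by rewrite mulr_sumr; apply: eq_bigr => i _; rewrite mxE mulrA. Qed.

Lemma dotDr u v w : dot w (u + v) = dot w u + dot w v.
Proof. by rewrite !(dotC w) dotDl. Qed.

Lemma dotZr (a : R) u v : dot u (a *: v) = a * dot u v.
Proof. by rewrite !(dotC u) dotZl. Qed.

Lemma dotNl u v : dot (- u) v = - dot u v.
Proof. by rewrite -scaleN1r dotZl mulN1r. Qed.

Lemma dotNr u v : dot u (- v) = - dot u v.
Proof. by rewrite dotC dotNl dotC. Qed.

Lemma dot0l u : dot 0 u = 0.
Proof. by rewrite -(scale0r 0) dotZl mul0r. Qed.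

Definition dotE := (dotDl, dotDr, dotZl, dotZr, dotNl, dotNr).

Lemma dot_comb (a b : R) u v : dot (a *: u + b *: v) (a *: u + b *: v) =
  a ^+ 2 * dot u u + 2 * a * b * dot u v + b ^+ 2 * dot v v.
Proof. by rewrite !dotE (dotC v u); ring. Qed.

Lemma dot_ge0 u : 0 <= dot u u.
Proof. by apply: sumr_ge0 => i _; rewrite -expr2 sqr_ge0. Qed.

Lemma dot_eq0 u : dot u u <= 0 -> u = 0.
Proof.
move=> u_le0; apply/rowP => i; rewrite mxE; apply/eqP.
have := dot_ge0 u.
rewrite le_eqVlt ltNge u_le0 orbF eq_sym psumr_eq0; last first.
  by move=> j _; rewrite -expr2 sqr_ge0.
by move=> /allP/(_ i (mem_index_enum _))/=; rewrite mulf_eq0 orbb.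
Qed.

Lemma enormK u : enorm u ^+ 2 = dot u u.
Proof. by rewrite sqr_sqrtr // dot_ge0. Qed.

Lemma enormN u : enorm (- u) = enorm u.
Proof. by rewrite /enorm dotNl dotNr opprK. Qed.

Lemma enorm_ge0 u : 0 <= enorm u.
Proof. exact: sqrtr_ge0. Qed.

(** Cauchy-Schwarz: expand the square of [|v|^2 u - <u,v> v]. *)
Lemma dot_le_enorm u v : dot u v <= enorm u * enorm v.
Proof.
have [uv0|uv0] := leP (dot u v) 0.
  by rewrite (le_trans uv0) // mulr_ge0 ?enorm_ge0.
rewrite -(ler_pXn2r (n := 2)) ?nnegrE ?mulr_ge0 ?enorm_ge0 ?(ltW uv0) //.
rewrite exprMn !enormK.
have [v0|v0] := leP (dot v v) 0.
  by move: uv0; rewrite (dot_eq0 v0) dotC dot0l ltxx.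
have := dot_ge0 (dot v v *: u - dot u v *: v).
rewrite !dotE (dotC v u) => h; rewrite -(ler_pM2l v0); vnra.
Qed.

Lemma coord_le_enorm u i : `|u 0 i| <= enorm u.
Proof.
rewrite -(ler_pXn2r (n := 2)) ?nnegrE ?enorm_ge0 //.
rewrite enormK real_normK ?num_real // /dot (bigD1 i) //= expr2 lerDl.
by apply: sumr_ge0 => j _; rewrite -expr2 sqr_ge0.
Qed.

Lemma young (t : R) u v : 0 < t ->
  dot u v <= dot u u / (2 * t) + t / 2 * dot v v.
Proof.
move=> t0; have := dot_ge0 (1 *: u + (- t) *: v); rewrite dot_comb.
move: (dot u u) (dot u v) (dot v v) => U X V sq.
have c_ge0 : 0 <= (2 * t)^-1 by rewrite invr_ge0 mulr_ge0 // ltW.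
have := mulr_ge0 c_ge0 sq.
have -> : (2 * t)^-1 * (1 ^+ 2 * U + 2 * 1 * - t * X + (- t) ^+ 2 * V) =
    U / (2 * t) - X + t / 2 * V by field; rewrite gt_eqF.
lra.
Qed.

End Dot.

(** Applied with [t] the length of a step, [a] the first-order change along it
    and [b] the coefficient of a quadratic remainder. *)
Lemma le0_of_le_small (R : realType) (a b : R) :
  (forall t, 0 < t -> t <= 1 -> a <= t * b) -> a <= 0.
Proof.
move=> h; rewrite leNgt; apply/negP => a0.
have ab := h 1 ltr01 (lexx _); rewrite mul1r in ab.
have b0 : 0 < b := lt_le_trans a0 ab.
have := h (a / (2 * b)); rewrite divr_gt0 ?mulr_gt0 // => /(_ isT).
rewrite ler_pdivrMr ?mulr_gt0 // (_ : a / (2 * b) * b = a / 2); last first.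
  by field; rewrite gt_eqF.
move=> /(_ ltac:(lra)); lra.
Qed.

Lemma convex_funP (R : realType) (n : nat) (h : 'rV[R]_n -> R) : convex_fun h ->
  forall (t : R) x u, 0 < t -> t <= 1 ->
    h (x + t *: (u - x)) <= h x + t * (h u - h x).
Proof.
move=> hc t x u t0 t1.
have := hc (Itv01 (ltW t0) t1) u x; rewrite !inE => /(_ I I).
rewrite /conv /= /conv /= /unstable.onem.
have -> : t *: u + (1 - t) *: x = x + t *: (u - x).
  by rewrite scalerBl scale1r scalerBr addrCA.
move=> /le_trans; apply; rewrite /GRing.scale /=; lra.
Qed.

(** * Smooth convex functions *)

(** The mean value theorem for [a t - (s t + K t^2 / 2)], whose derivative is
    nonpositive. *)
Lemma taylor_le (R : realType) (a da : R -> R) (s K : R) :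
  (forall t : R, is_derive t 1 a (da t)) ->
  (forall t : R, 0 <= t -> da t <= s + K * t) ->
  a 1 <= a 0 + s + K / 2.
Proof.
move=> dera bound.
pose b t := a t - (s * t + K / 2 * t ^+ 2).
have derb (t : R) : is_derive t 1 b (da t - (s + K * t)).
  have := dera t => ?.
  rewrite /b; apply: is_derive_eq.
  by rewrite /GRing.scale /=; field.
have [|c c01] := @MVT R b _ 0 1 ltr01 (fun t _ => derb t).
  apply: derivable_within_continuous => t _; exact: ex_derive.
have := bound c; rewrite (itvP c01) => /(_ isT).
rewrite /b; lra.
Qed.

Section Smooth.
Variables (R : realType) (n : nat) (f : 'rV[R]_n -> R) (M : R).
Hypotheses (f_convex : convex_fun f) (f_smooth : smooth M f).

Lemma dot_grad x v : dot (grad f x) v = 'd f x v.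
Proof.
rewrite [in RHS](row_sum_delta v) linear_sum; apply: eq_bigr => i _.
by rewrite linearZ mxE mulrC.
Qed.

Let is_derive_line x v (t : R) :
  is_derive t 1 (fun t => f (x + t *: v)) (dot (grad f (x + t *: v)) v).
Proof.
have [df _] := f_smooth.
have dl : is_diff t (fun t : R => x + t *: v) (fun t : R => t *: v).
  by apply: is_diff_eq; rewrite add0r.
have dfx := differentiableP (df (x + t *: v)).
have dc := is_diff_comp dl dfx.
apply: DeriveDef; first exact: diff_derivable.
by rewrite deriveE // diff_val /= scale1r dot_grad.
Qed.

Let grad_line x v (t : R) : 0 <= t ->
  dot (grad f (x + t *: v)) v <= dot (grad f x) v + M * dot v v * t /\
  - dot (grad f (x + t *: v)) v <= - dot (grad f x) v + M * dot v v * t.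
Proof.
move=> t0; have [_ lipf] := f_smooth.
have lip := lipf (x + t *: v) x.
have nv : enorm (x + t *: v - x) = t * enorm v.
  by rewrite addrAC subrr add0r /enorm !dotE mulrA -expr2 sqrtrM ?sqr_ge0 //
    sqrtr_sqr ger0_norm.
have bound d : enorm d <= M * enorm (x + t *: v - x) ->
    dot d v <= M * dot v v * t.
  rewrite nv => d_le; apply: le_trans (dot_le_enorm d v) _.
  apply: le_trans (ler_wpM2r (enorm_ge0 v) d_le) _.
  by rewrite -enormK expr2 le_eqVlt; apply/orP; left; apply/eqP; ring.
move: (grad f _) (grad f _) lip => g0 g lip; split.
- by have := bound _ lip; rewrite dotDl dotNl => ?; vlra.
- have := bound (- (g - g0)); rewrite enormN => /(_ lip).
  by rewrite dotNl dotDl dotNl => ?; vlra.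
Qed.

Lemma smooth_quad x u :
  `|f u - f x - dot (grad f x) (u - x)| <= M / 2 * dot (u - x) (u - x).
Proof.
have := taylor_le (fun t => is_deriveN (is_derive_line x (u - x) t))
  (fun t t0 => (grad_line x (u - x) t0).2).
have := taylor_le (is_derive_line x (u - x))
  (fun t t0 => (grad_line x (u - x) t0).1).
rewrite !fctE scale0r addr0 scale1r (addrC x) subrK ler_norml => up dn.
by apply/andP; split; vlra.
Qed.

Lemma grad_subdiff x : subdiff f x (grad f x).
Proof.
move=> u; rewrite -subr_le0.
apply: (@le0_of_le_small _ _ (M / 2 * dot (u - x) (u - x))) => t t0 t1.
have := smooth_quad x (x + t *: (u - x)); rewrite ler_norml => /andP[+ _].
have := convex_funP f_convex x u t0 t1.
rewrite (addrAC x) subrr add0r !dotZl !dotZr => h1 h2.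
by rewrite -(ler_pM2l t0); vlra.
Qed.

(** The only subgradient is the gradient: along [v = g - grad f x], the lower
    bound given by [g] and the quadratic upper bound given by the gradient
    contradict each other for short steps unless [v = 0]. *)
Lemma subdiff_upper x g u : subdiff f x g ->
  f u <= f x + dot g (u - x) + M / 2 * dot (u - x) (u - x).
Proof.
move=> gx; suff -> : g = grad f x.
  by have := smooth_quad x u; rewrite ler_norml => /andP[_ ?]; vlra.
apply/eqP; rewrite -subr_eq0; apply/eqP/dot_eq0; set v := g - _.
apply: (@le0_of_le_small _ _ (M / 2 * dot v v)) => t t0 _.
have := smooth_quad x (x + t *: v); rewrite ler_norml => /andP[_].
have := gx (x + t *: v).
rewrite (addrAC x) subrr add0r !dotZl !dotZr {3}/v dotDl dotNl => h1 h2.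
by rewrite -(ler_pM2l t0); vlra.
Qed.

End Smooth.

(** * One proximal step *)

Lemma three_point (R : realType) (n : nat) (y w u : 'rV[R]_n) :
  dot (u - y) (u - y) =
  dot (w - y) (w - y) + dot (u - w) (u - w) - 2 * dot (y - w) (u - w).
Proof.
have -> : u - y = (u - w) - (y - w) by rewrite opprB addrA subrK.
rewrite -(opprB y w); move: (u - w) (y - w) => p q.
rewrite !dotE (dotC p q); ring.
Qed.

Lemma prox_objective_center (R : realType) (n : nat) (h : 'rV[R]_n -> R)
    (rho : R) (y : 'rV[R]_n) : prox_objective h rho y y = h y.
Proof.
by rewrite /prox_objective subrr /enorm dot0l sqrtr0 expr0n /= mulr0 addr0.
Qed.

(** Moving from [w] a fraction [t] of the way to [u] changes the proximal term
    by a linear part and a part of order [t^2], while convexity bounds the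
    change of [m] linearly. *)
Lemma prox_subdiff (R : realType) (n : nat) (m : 'rV[R]_n -> R) (rho : R)
    (y w : 'rV[R]_n) : convex_fun m ->
  argmin (prox_objective m rho y) w -> subdiff m w (rho *: (y - w)).
Proof.
move=> m_convex w_min u; rewrite -subr_le0.
apply: (@le0_of_le_small _ _ (rho / 2 * dot (u - w) (u - w))) => t t0 t1.
have := w_min (w + t *: (u - w)); have := convex_funP m_convex w u t0 t1.
rewrite /prox_objective !enormK (three_point y w (w + _)).
have -> : w + t *: (u - w) - w = t *: (u - w) by rewrite addrC addKr.
rewrite !dotZl !dotZr => h1 h2.
rewrite -(ler_pM2l t0); vnra.
Qed.

(** Minimize the affine minorant plus the proximal term over all points. *)
Lemma prox_value_ge (R : realType) (n : nat) (f m : 'rV[R]_n -> R) (rho : R)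
    (y w g : 'rV[R]_n) : 0 < rho -> (forall u, f y + dot g (u - y) <= m u) ->
  f y - dot g g / (2 * rho) <= prox_objective m rho y w.
Proof.
move=> rho_gt0 cut; rewrite /prox_objective enormK.
have := cut w; have := dot_ge0 (1 *: g + rho *: (w - y)).
rewrite dot_comb; move: (dot g (w - y)) (dot g g) (dot (w - y) _) => X E D sq h.
have c_ge0 : 0 <= (2 * rho)^-1 by rewrite invr_ge0 mulr_ge0 // ltW.
have := mulr_ge0 c_ge0 sq.
have -> : (2 * rho)^-1 * (1 ^+ 2 * E + 2 * 1 * rho * X + rho ^+ 2 * D) =
    E / (2 * rho) + X + rho / 2 * D by field; rewrite gt_eqF.
vlra.
Qed.

Lemma null_gap (R : realType) (n : nat) (f m : 'rV[R]_n -> R) (rho beta : R)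
    (y w : 'rV[R]_n) : 0 < rho -> beta < 1 -> ~~ descent_test f m beta y w ->
  (1 - beta) * (f y - prox_objective m rho y w) < f w - m w.
Proof.
move=> rho_gt0 beta_lt1; rewrite /descent_test -ltNge => null.
have : 0 <= (1 - beta) * (rho / 2 * enorm (w - y) ^+ 2).
  by rewrite !mulr_ge0 ?enorm_ge0 ?subr_ge0 ?invr_ge0
    ?(ltW beta_lt1) ?(ltW rho_gt0).
rewrite /prox_objective; vlra.
Qed.

Section ModelStep.
Variables (R : realType) (n : nat) (f : 'rV[R]_n -> R) (M : R).
Hypothesis M_gt0 : 0 < M.
Hypothesis f_upper : forall x g u, subdiff f x g ->
  f u <= f x + dot g (u - x) + M / 2 * dot (u - x) (u - x).
Variables (m : 'rV[R]_n -> R) (w : 'rV[R]_n).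
Hypothesis m_le_f : forall u, m u <= f u.

(** The quadratic upper bound at [w] cannot cross the affine minorant of [m]
    below it; the gap [f w - m w] therefore limits the difference of slopes. *)
Lemma slope_gap g s : subdiff f w g -> subdiff m w s ->
  dot (g - s) (g - s) <= 2 * M * (f w - m w).
Proof.
move=> gw sw; pose d := - (M^-1 *: (g - s)).
have := le_trans (sw (w + d)) (le_trans (m_le_f _) (f_upper (w + d) gw)).
have -> : w + d - w = d by rewrite addrC addKr.
have gsE : dot (g - s) d = dot g d - dot s d by rewrite dotDl dotNl.
have : dot (g - s) d = - (M^-1 * dot (g - s) (g - s)) by rewrite dotNr dotZr.
have : dot d d = M^-1 * (M^-1 * dot (g - s) (g - s)).
  by rewrite dotNl dotNr opprK dotZl dotZr.
move: (dot (g - s) (g - s)) gsE => G -> dd gd h.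
have : G * M^-1 <= 2 * (f w - m w).
  have : M / 2 * dot d d = G * M^-1 / 2 by rewrite dd; field; rewrite gt_eqF.
  vlra.
by rewrite ler_pdivrMr // => /le_trans; apply; vlra.
Qed.

Variables (rho : R) (y : 'rV[R]_n).
Hypothesis rho_gt0 : 0 < rho.
Hypothesis m_convex : convex_fun m.
Hypothesis w_min : argmin (prox_objective m rho y) w.

Let pval := prox_objective m rho y w.

(** Averaging the two minorants of [l] with weight [theta = rho/(2(M+rho))] on
    the cut raises the bound at [w] by [theta] times the gap, and adds a slope
    [theta (g - s)] that the strong convexity of the proximal term pays for. *)
Lemma prox_gain (l : 'rV[R]_n -> R) g : subdiff f w g ->
  (forall u, f w + dot g (u - w) <= l u) ->
  (forall u, m w + dot (rho *: (y - w)) (u - w) <= l u) ->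
  forall u, pval + rho / (4 * (M + rho)) * (f w - m w)
    <= prox_objective l rho y u.
Proof.
move=> gw cut agg u.
have gap := slope_gap gw (prox_subdiff m_convex w_min).
have h0 : 0 <= f w - m w by rewrite subr_ge0.
have := cut u; have := agg u; rewrite /pval /prox_objective !enormK.
rewrite (three_point y w u).
set s := rho *: (y - w) in gap *.
have -> : dot (y - w) (u - w) = rho^-1 * dot s (u - w).
  by rewrite dotZl mulKf // gt_eqF.
pose theta := rho / (2 * (M + rho)).
have psE : dot (g - s) (u - w) = dot g (u - w) - dot s (u - w).
  by rewrite dotDl dotNl.
move: (g - s) (u - w) gap psE => p d gap psE.
(* Completing the square of the averaged slope and the proximal term. *)
have := dot_ge0 (theta *: p + rho *: d).
rewrite dot_comb psE.
move: (dot p p) gap => G gap.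
move: (dot d d) (dot (w - y) (w - y)) => D Y.
move: (dot g _) (dot s _) => a b.
move: (f w) (m w) (l u) gap h0 => fw mw lu gap h0 sq h1 h2.
have th : theta * (2 * (M + rho)) = rho.
  by rewrite /theta; field; rewrite gt_eqF ?addr_gt0.
have thp : 0 < theta by rewrite divr_gt0 ?mulr_gt0 ?addr_gt0.
have -> : rho / (4 * (M + rho)) = theta / 2.
  by rewrite /theta; field; rewrite gt_eqF ?addr_gt0.
have -> : rho / 2 * (Y + D - 2 * (rho^-1 * b)) = rho / 2 * Y + rho / 2 * D - b.
  by field; rewrite gt_eqF.
rewrite -(ler_pM2l rho_gt0).
have th1 : theta <= 1.
  rewrite /theta ler_pdivrMr ?mulr_gt0 ?addr_gt0 //; vlra.
clearbody theta.
have avg : (1 - theta) * (mw + b) + theta * (fw + a) <= lu.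
  have th0 : 0 <= 1 - theta by rewrite subr_ge0.
  have := ler_wpM2l (ltW thp) h2; have := ler_wpM2l th0 h1; vlra.
have avg2 := ler_wpM2l (ltW rho_gt0) avg.
have gap2 : theta ^+ 2 * G <= theta ^+ 2 * (2 * M * (fw - mw)).
  by rewrite ler_wpM2l ?sqr_ge0.
have key : theta ^+ 2 * (2 * M * (fw - mw)) <= theta * rho * (fw - mw).
  have -> : theta * rho * (fw - mw) =
      theta * (theta * (2 * (M + rho))) * (fw - mw) by rewrite th.
  have : 0 <= theta * theta * rho * (fw - mw).
    by rewrite !mulr_ge0 ?(ltW thp) ?(ltW rho_gt0).
  vlra.
vlra.
Qed.

(** Compare with one step of length [1 / (M + rho)] from [y] along [- g]. *)
Lemma prox_value_le g : subdiff f y g ->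
  pval <= f y - dot g g / (2 * (M + rho)).
Proof.
move=> gy; pose d := - ((M + rho)^-1 *: g).
apply: le_trans (w_min (y + d)) _; rewrite /prox_objective enormK.
have := le_trans (m_le_f _) (f_upper (y + d) gy).
have -> : y + d - y = d by rewrite addrC addKr.
rewrite /d !(dotNl, dotNr, opprK) !(dotZl, dotZr) -/d.
move: (m (y + d)) (dot g g) => mu E h.
have Mr : M + rho != 0 by rewrite gt_eqF ?addr_gt0.
apply: le_trans (_ : f y - (M + rho)^-1 * E +
  (M + rho) / 2 * ((M + rho)^-1 * ((M + rho)^-1 * E)) <= _); first by vlra.
by rewrite le_eqVlt; apply/orP; left; apply/eqP; field.
Qed.

End ModelStep.

(** * Outer iterations *)

Section Descent.
Variables (R : realType) (n : nat) (f : 'rV[R]_n -> R) (M rho beta c : R).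
Hypotheses (M_gt0 : 0 < M) (rho_gt0 : 0 < rho) (beta_lt1 : beta < 1).
Hypotheses (c_gt0 : 0 < c) (M_le : M <= c * rho).
Hypothesis beta_large :
  (1 - beta) * (c + 2 * Num.sqrt c + 2) <= beta.
Hypothesis f_upper : forall x g u, subdiff f x g ->
  f u <= f x + dot g (u - x) + M / 2 * dot (u - x) (u - x).
Hypothesis f_subdiff : forall x, exists g, subdiff f x g.

(** With [eps = f w - m w] and [D = |w - y|^2], smoothness gives
    [f y - f w <= rho D + sqrt (2 M eps) sqrt D + M/2 D]. If [eps > rho D / 2],
    the right side is below [(2 + 2 sqrt c + c) eps], whereas the descent test
    makes the left side at least [beta / (1 - beta) eps]. The product of square
    roots is split by Young's inequality with weight [rho sqrt c]. *)
Lemma descent_error (m : 'rV[R]_n -> R) y w :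
  (forall u, m u <= f u) -> subdiff m w (rho *: (y - w)) ->
  descent_test f m beta y w -> f w - m w <= rho / 2 * dot (y - w) (y - w).
Proof.
move=> m_le_f sw test; have [g gw] := f_subdiff w.
have gap := slope_gap M_gt0 f_upper m_le_f gw sw.
have yg := f_upper y gw.
have q2 : Num.sqrt c ^+ 2 = c by rewrite sqr_sqrtr // ltW.
have q0 : 0 < Num.sqrt c by rewrite sqrtr_gt0.
rewrite leNgt; apply/negP => big.
move: (Num.sqrt c) beta_large q2 q0 => q beta_q q2 q0.
have yo := young (g - rho *: (y - w)) (y - w) (mulr_gt0 rho_gt0 q0).
move: yo; rewrite {1}dotDl dotNl dotZl.
move: (dot (g - _) _) gap (dot_ge0 (y - w)) big yg test; rewrite /descent_test.
move: (dot (y - w) (y - w)) (dot g _) => D G P.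
move: (f y) (f w) (m w) => fy fw mw gap D0 big yg test yo.
have e0 : 0 < fw - mw.
  by apply: le_lt_trans big; rewrite mulr_ge0 // ltW // divr_gt0.
have P_le : P / (2 * (rho * q)) <= q * (fw - mw).
  rewrite ler_pdivrMr ?mulr_gt0 //; apply: le_trans gap _.
  have : 2 * (fw - mw) * M <= 2 * (fw - mw) * (c * rho).
    by rewrite ler_wpM2l // mulr_ge0 // ltW.
  rewrite -q2; lra.
have MD : M * D <= q ^+ 2 * rho * D by rewrite ler_wpM2r // q2.
have qD : q * (rho * D) <= q * (2 * (fw - mw)) by rewrite ler_pM2l //; lra.
have qqD : q ^+ 2 * (rho * D) <= q ^+ 2 * (2 * (fw - mw)).
  by rewrite ler_pM2l ?exprn_gt0 //; lra.
have up : fy - fw < (c + 2 * q + 2) * (fw - mw) by rewrite -q2; lra.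
have b1 : 0 < 1 - beta by rewrite subr_gt0.
have := ler_wpM2r (ltW e0) beta_q.
have : (1 - beta) * (fy - fw) < (1 - beta) * ((c + 2 * q + 2) * (fw - mw)).
  by rewrite ltr_pM2l.
lra.
Qed.

End Descent.

Section Lyapunov.
Variables (R : realType) (n : nat).

(** The energy estimate of one accelerated step. The two affine minorants at
    [x] and at the reference point [u] are averaged with weights [A] and [a];
    since [A' y = A x + a z], the average only involves [y - w] and [z - u],
    and the squared-distance term absorbs the cross product. *)
Lemma energy_step (f m : 'rV[R]_n -> R) (rho A a A' : R)
    (x z y w u : 'rV[R]_n) :
  0 <= A -> 0 <= a -> A' = A + a -> a ^+ 2 = A' ->
  A' *: y = A *: x + a *: z ->
  (forall u, m u <= f u) -> subdiff m w (rho *: (y - w)) ->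
  f w - m w <= rho / 2 * dot (y - w) (y - w) ->
  A' * (f w - f u) + rho / 2 * dot (z - a *: (y - w) - u) (z - a *: (y - w) - u)
    <= A * (f x - f u) + rho / 2 * dot (z - u) (z - u).
Proof.
move=> A0 a0 A'E aA' yE m_le_f sw err.
have hx := le_trans (sw x) (m_le_f x); have hu := le_trans (sw u) (m_le_f u).
have vE : A *: (x - w) + a *: (u - w) = A' *: (y - w) + (- a) *: (z - u).
  apply/rowP => i; have /rowP/(_ i) := yE; rewrite !mxE A'E; lra.
have : dot (y - w) (A *: (x - w) + a *: (u - w)) =
       dot (y - w) (A' *: (y - w) + (- a) *: (z - u)) by rewrite vE.
have -> : z - a *: (y - w) - u = 1 *: (z - u) + (- a) *: (y - w).
  by rewrite scale1r scaleNr addrAC.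
rewrite dot_comb (dotC (z - u) (y - w)).
move: hx hu err; rewrite !dotZl.
move: (y - w) (x - w) (u - w) (z - u) => p xw uw zu.
rewrite !(dotDr, dotZr).
move: (dot p p) (dot p xw) (dot p uw) (dot p zu) (dot zu zu) => P X U Z Q.
move: (f w) (m w) (f x) (f u) => fw mw fx fu hx hu err dE.
have := ler_wpM2l A0 hx; have := ler_wpM2l a0 hu.
have A'0 : 0 <= A' by rewrite A'E addr_ge0.
have := ler_wpM2l A'0 err.
have : rho * (A * X + a * U) = rho * (A' * P + - a * Z) by rewrite dE.
rewrite sqrrN aA' A'E; lra.
Qed.

Lemma Aseq_ge0 k : 0 <= Aseq R k.
Proof.
by elim: k => //= k IH; rewrite addr_ge0 // divr_ge0 // addr_ge0 // sqrtr_ge0.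
Qed.

Lemma AseqS k : Aseq R k.+1 = Aseq R k + aseq R k.
Proof. by []. Qed.

Let root_sq k : Num.sqrt (1 + 4 * Aseq R k) ^+ 2 = 1 + 4 * Aseq R k.
Proof. by rewrite sqr_sqrtr // addr_ge0 // mulr_ge0 // Aseq_ge0. Qed.

Lemma aseq_gt0 k : 0 < aseq R k.
Proof. by rewrite divr_gt0 // ltr_wpDr // sqrtr_ge0. Qed.

Lemma aseq_sq k : aseq R k ^+ 2 = Aseq R k.+1.
Proof.
rewrite AseqS /aseq; have := root_sq k; move: (Num.sqrt _) => r; lra.
Qed.

(** [sqrt (1 + 4 A_k)] is at least [k], because [a_k >= sqrt A_k + 1/2] makes
    [sqrt A_k] grow by at least 1/2 at each step. *)
Lemma Aseq_ge k : k%:R ^+ 2 / 4 <= Aseq R k.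
Proof.
elim: k => [|k IH]; first by rewrite expr0n /= mul0r.
rewrite AseqS /aseq; have := root_sq k.
have : k%:R <= Num.sqrt (1 + 4 * Aseq R k).
  rewrite -(ler_pXn2r (n := 2)) ?nnegrE ?sqrtr_ge0 // root_sq; lra.
have -> : k.+1%:R = k%:R + 1 :> R by rewrite natr1.
move: (Num.sqrt _) (k%:R : R) IH => r x IH *; lra.
Qed.

Lemma center_comb k (x z : 'rV[R]_n) :
  Aseq R k.+1 *: Defs.center k x z = Aseq R k *: x + aseq R k *: z.
Proof.
have A0 : Aseq R k.+1 != 0.
  by rewrite gt_eqF // -aseq_sq exprn_gt0 // aseq_gt0.
by rewrite scalerDr !scalerA !(mulrC (Aseq R k.+1)) !divfK.
Qed.

End Lyapunov.

(** * Counting the inner iterations *)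

Section Method.
Variables (R : realType) (n : nat) (f : 'rV[R]_n -> R) (M rho beta : R).
Hypotheses (M_gt0 : 0 < M) (rho_gt0 : 0 < rho) (beta_lt1 : beta < 1).
Hypothesis f_upper : forall x g u, subdiff f x g ->
  f u <= f x + dot g (u - x) + M / 2 * dot (u - x) (u - x).
Hypothesis f_subdiff : forall x, exists g, subdiff f x g.

Implicit Types (s : state R n) (x z : 'rV[R]_n).

(** The states that a call can reach after [i.+1] null steps. The first model
    gives the initial bound on [f y] minus the proximal value; each of the [i]
    later ones improves it by a fixed multiple of [|g|^2]. *)
Definition after_nulls (i k : nat) x z s : Prop :=
  exists m w g, let y := Defs.center k x z in
    [/\ s = State k x z w (Some m),
        [/\ convex_fun m, forall u, m u <= f u &
            argmin (prox_objective m rho y) w],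
        ~~ descent_test f m beta y w,
        subdiff f y g &
        f y - prox_objective m rho y w <=
          dot g g / (2 * rho)
          - i%:R * (rho * (1 - beta) / (8 * (M + rho) ^+ 2) * dot g g)].

Definition call_done (k : nat) s : Prop := exists x z, s = start k x z.

Lemma first_null k x z s : step f rho beta (start k x z) s ->
  call_done k.+1 s \/ after_nulls 0 k x z s.
Proof.
case=> m w [m_convex m_le_f [g gy cut] _] w_min test.
- right; exists m, w, g; split=> //.
  by rewrite mul0r subr0 lerBlDr -lerBlDl prox_value_ge.
- by left; do 2 eexists.
Qed.

Lemma next_null i k x z s s' : after_nulls i k x z s ->
  step f rho beta s s' -> call_done k.+1 s' \/ after_nulls i.+1 k x z s'.
Proof.
move=> [m [w [g [-> [m_convex m_le_f w_min] null gy gap]]]].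
case=> m' w' [/= m'_convex m'_le_f [g' g'w cut] agg] w'_min test; last first.
  by left; do 2 eexists.
right; exists m', w', g; split=> //.
rewrite /yk /= in agg w'_min.
move: (Defs.center k x z) => y in w_min null gy gap agg w'_min test *.
have gain :=
  prox_gain M_gt0 f_upper m_le_f rho_gt0 m_convex w_min g'w cut agg w'.
have h_gt := null_gap rho_gt0 beta_lt1 null.
have p_le := prox_value_le M_gt0 f_upper m_le_f rho_gt0 w_min gy.
have -> : i.+1%:R = i%:R + 1 :> R by rewrite natr1.
move: (prox_objective m rho y w) (prox_objective m' rho y w')
  p_le h_gt gain gap.
move: (f y) (f w) (m w) (dot g g) (i%:R : R).
move=> fy fw mw E I p p' p_le h_gt gain gap.
have b0 : 0 < 1 - beta by rewrite subr_gt0.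
have Mr : 0 < M + rho by rewrite addr_gt0.
have c0 : 0 < rho / (4 * (M + rho)) by rewrite divr_gt0 // mulr_gt0.
have lift : rho * (1 - beta) / (8 * (M + rho) ^+ 2) * E <=
    rho / (4 * (M + rho)) * (fw - mw).
  have -> : rho * (1 - beta) / (8 * (M + rho) ^+ 2) * E =
     rho / (4 * (M + rho)) * ((1 - beta) * (E / (2 * (M + rho)))).
    by field; rewrite gt_eqF.
  rewrite ler_pM2l //; apply: le_trans (ltW h_gt); rewrite ler_pM2l //; vlra.
vlra.
Qed.

(** The improvements cannot bring [f y] minus the proximal value below
    [|g|^2 / (2 (M + rho))]; dividing by [|g|^2] bounds their number. *)
Lemma after_nulls_bound i k x z s : after_nulls i k x z s ->
  i%:R <= 4 * M * (M + rho) / (rho ^+ 2 * (1 - beta)).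
Proof.
move=> [m [w [g [_ [m_convex m_le_f w_min] null gy gap]]]].
move: (Defs.center k x z) => y in w_min null gy gap *.
have b0 : 0 < 1 - beta by rewrite subr_gt0.
have Mr : 0 < M + rho by rewrite addr_gt0.
have p_le := prox_value_le M_gt0 f_upper m_le_f rho_gt0 w_min gy.
have h_gt := null_gap rho_gt0 beta_lt1 null.
have [g' g'w] := f_subdiff w.
(* As [f] itself lies above both cuts, the null step also shows that the
   proximal value is below [f y], hence that [g] is nonzero. *)
have := prox_gain M_gt0 f_upper m_le_f rho_gt0 m_convex w_min g'w g'w
  (fun u => le_trans (prox_subdiff m_convex w_min u) (m_le_f u)) y.
rewrite prox_objective_center.
move: (prox_objective m rho y w) p_le h_gt gap (dot_ge0 g).
move: (f y) (f w) (m w) (dot g g) (i%:R : R).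
move=> fy fw mw E I p p_le h_gt gap E0 gain.
have c0 : 0 < rho / (4 * (M + rho)) by rewrite divr_gt0 // mulr_gt0.
have p_le_fy : p <= fy.
  by apply: le_trans p_le _; rewrite gerBl divr_ge0 // mulr_ge0 // ltW.
have h0 : 0 < fw - mw.
  by apply: le_lt_trans h_gt; rewrite mulr_ge0 ?(ltW b0) ?subr_ge0.
have ch0 := mulr_gt0 c0 h0.
have Epos : 0 < E.
  rewrite lt_neqAle E0 andbT; apply/eqP => Ez.
  by rewrite -Ez !(mul0r, mulr0) in gap; vlra.
have drop : I * (rho * (1 - beta) / (8 * (M + rho) ^+ 2) * E) <=
    M / (2 * rho * (M + rho)) * E.
  have -> : M / (2 * rho * (M + rho)) * E = E / (2 * rho) - E / (2 * (M + rho)).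
    by field; rewrite !gt_eqF.
  vlra.
rewrite mulrA ler_pM2r // in drop.
rewrite ler_pdivlMr ?mulr_gt0 ?exprn_gt0 //.
have q0 : 0 < 8 * (M + rho) ^+ 2 * rho by rewrite !mulr_gt0 // exprn_gt0.
have := ler_wpM2l (ltW q0) drop.
have -> : 8 * (M + rho) ^+ 2 * rho *
      (I * (rho * (1 - beta) / (8 * (M + rho) ^+ 2)))
    = I * (rho ^+ 2 * (1 - beta)) by field; rewrite gt_eqF.
have -> : 8 * (M + rho) ^+ 2 * rho * (M / (2 * rho * (M + rho)))
    = 4 * M * (M + rho) by field; rewrite !gt_eqF.
by [].
Qed.

(** [after_nulls i] is impossible for [i] one more than the integer part of its
    bound, and it describes the state after [i.+1] inner iterations; hence the
    offset 2. *)
Definition call_length : nat :=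
  (Num.truncn (4 * M * (M + rho) / (rho ^+ 2 * (1 - beta)))).+2.

Section Execution.
Variables (x0 : 'rV[R]_n) (r : nat -> state R n).
Hypothesis r_exec : execution f rho beta x0 r.

Lemma call_ends t k x z : r t = start k x z ->
  exists2 j, (j <= call_length)%N & call_done k.+1 (r (t + j)).
Proof.
have [_ r_step] := r_exec; move=> rt.
have run i : (exists2 j, (j <= i.+1)%N & call_done k.+1 (r (t + j))) \/
    after_nulls i k x z (r (t + i.+1)).
  elim: i => [|i [[j ji done]|nulls]].
  - rewrite addn1; have := r_step t.
    rewrite rt => /first_null[done|]; last by right.
    by left; exists 1%N => //; rewrite addn1.
  - by left; exists j => //; exact: leqW.
  - rewrite (addnS t i.+1); have := r_step (t + i.+1)%N.
    move=> /(next_null nulls)[done|]; last by right.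
    by left; exists i.+2 => //; rewrite (addnS t i.+1).
pose B := 4 * M * (M + rho) / (rho ^+ 2 * (1 - beta)).
have [//|/after_nulls_bound] := run (Num.truncn B).+1.
by rewrite leNgt truncnS_gt.
Qed.

Lemma outer_reached k :
  exists2 t, (t <= k * call_length)%N & call_done k (r t).
Proof.
elim: k => [|k [t tk [x [z rt]]]].
  by exists 0%N => //; exists x0, x0; case: r_exec.
have [j jN done] := call_ends rt.
by exists (t + j)%N; rewrite // mulSn addnC leq_add.
Qed.

End Execution.

End Method.

(** * Convergence rate *)

Section Rate.
Variables (R : realType) (n : nat) (f : 'rV[R]_n -> R) (M rho beta c : R).
Hypotheses (M_gt0 : 0 < M) (rho_gt0 : 0 < rho) (beta_lt1 : beta < 1).
Hypotheses (c_gt0 : 0 < c) (M_le : M <= c * rho).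
Hypothesis beta_large : (1 - beta) * (c + 2 * Num.sqrt c + 2) <= beta.
Hypothesis f_upper : forall x g u, subdiff f x g ->
  f u <= f x + dot g (u - x) + M / 2 * dot (u - x) (u - x).
Hypothesis f_subdiff : forall x, exists g, subdiff f x g.

Variables (x0 : 'rV[R]_n) (r : nat -> state R n).
Hypothesis r_exec : execution f rho beta x0 r.

Lemma energy_le t u :
  Aseq R (outer (r t)) * (f (xk (r t)) - f u)
    + rho / 2 * dot (zk (r t) - u) (zk (r t) - u)
  <= rho / 2 * dot (x0 - u) (x0 - u).
Proof.
have [r0 r_step] := r_exec.
elim: t => [|t]; first by rewrite r0 /= mul0r add0r.
case: (r_step t) => // m w [m_convex m_le_f _ _] w_min test.
apply: le_trans; have sw := prox_subdiff m_convex w_min.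
apply: (energy_step u (m := m) (y := yk (r t))) => //.
- exact: Aseq_ge0.
- exact/ltW/aseq_gt0.
- exact: aseq_sq.
- exact: center_comb.
- exact: (descent_error M_gt0 rho_gt0 beta_lt1 c_gt0).
Qed.

Lemma rate k t u : (1 <= k)%N -> outer (r t) = k -> f u <= f (xk (r t)) ->
  f (xk (r t)) - f u <= 2 * rho / k%:R ^+ 2 * enorm (x0 - u) ^+ 2.
Proof.
move=> k1 outer_t u_le; have := energy_le t u; rewrite outer_t enormK.
have := Aseq_ge R k; have := dot_ge0 (zk (r t) - u).
have k0 : 0 < k%:R ^+ 2 :> R by rewrite exprn_gt0 // ltr0n.
move: (dot (zk _ - _) _) (dot (x0 - u) _) => Z D Z0 Ak energy.
have d0 : 0 <= f (xk (r t)) - f u by rewrite subr_ge0.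
move: (f (xk _)) (f u) d0 energy => fx fu d0 energy.
have := ler_wpM2r d0 Ak.
have : 0 <= rho / 2 * Z by rewrite mulr_ge0 // divr_ge0 // ltW.
move=> h1 h2; rewrite mulrAC ler_pdivlMr //; vlra.
Qed.

End Rate.

Lemma minval_argmin (R : realType) (n : nat) (h : 'rV[R]_n -> R) x :
  argmin h x -> minval h = h x.
Proof.
move=> x_min; apply/eqP; rewrite eq_le; apply/andP; split.
- by apply: ge_inf; [exists (h x) => _ [y _ <-]; exact: x_min | exists x].
- by apply: lb_le_inf; [exists (h x), x | move=> _ [y _ <-]; exact: x_min].
Qed.

(** The infimum defining [dist] need not be attained a priori, so a bound that
    holds for each point of [S] is passed to it through square roots. *)
Lemma le_dist_sq (R : realType) (n : nat) (x : 'rV[R]_n) (S : set 'rV[R]_n)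
    (C v : R) : S !=set0 -> 0 <= C ->
  (forall s, S s -> v <= C * enorm (x - s) ^+ 2) -> v <= C * dist x S ^+ 2.
Proof.
move=> [s0 Ss0] C0 bound.
have [v0|v0] := leP v 0; first by rewrite (le_trans v0) // mulr_ge0 // sqr_ge0.
have {C0}C0 : 0 < C.
  rewrite lt_neqAle C0 andbT; apply/eqP => Cz; move: (bound _ Ss0).
  by rewrite -Cz mul0r leNgt v0.
have vC0 : 0 <= v / C by rewrite divr_ge0 // ltW.
have root_le : Num.sqrt (v / C) <= dist x S.
  apply: lb_le_inf; first by exists (enorm (x - s0)), s0.
  move=> _ [s Ss <-]; rewrite -(ler_pXn2r (n := 2)) ?nnegrE ?sqrtr_ge0 //.
  by rewrite sqr_sqrtr // ler_pdivrMr // mulrC bound.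
rewrite mulrC -ler_pdivrMr // -(sqr_sqrtr vC0).
by rewrite ler_pXn2r ?nnegrE ?(le_trans _ root_le) ?sqrtr_ge0.
Qed.

(** * Existence of executions *)

Section Existence.
Variables (R : realType) (n : nat) (f : 'rV[R]_n -> R) (rho beta : R).
Hypotheses (rho_gt0 : 0 < rho) (beta_lt1 : beta < 1).
Hypotheses (f_convex : convex_fun f) (f_cont : continuous f).
Hypothesis f_subdiff : forall x, exists g, subdiff f x g.
Hypothesis f_min : argmin f !=set0.

Lemma prox_objective_continuous y : continuous (prox_objective f rho y).
Proof.
have quad : continuous (fun v : 'rV[R]_n => enorm (v - y) ^+ 2).
  have -> : (fun v => enorm (v - y) ^+ 2) = fun v => dot (v - y) (v - y).
    by apply/funext => v; rewrite enormK.
  apply: continuous_big => [|i _ v]; first exact: add_continuous.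
  have coord : (fun v : 'rV[R]_n => (v - y) 0 i) @ v --> (v - y) 0 i.
    have -> : (fun v : 'rV[R]_n => (v - y) 0 i) = fun v => v 0 i - y 0 i.
      by apply/funext => u; rewrite !mxE.
    rewrite !mxE.
    exact: (cvgB (@coord_continuous R 1 n 0 i v) (cvg_cst (y 0 i))).
  exact: (cvgM coord coord).
by move=> w; exact: (cvgD (@f_cont w) (cvgM (cvg_cst (rho / 2)) (quad w))).
Qed.

(** Outside the box of half-width [K] around [y] the quadratic term is at least
    [f y - min f], so a minimizer over the box is a minimizer. *)
Lemma prox_exists y : exists w, argmin (prox_objective f rho y) w.
Proof.
have [s s_min] := f_min.
pose K := Num.sqrt (2 * (f y - f s) / rho).
pose box := [set v : 'rV[R]_n |
  forall i, `[y 0 i - K, y 0 i + K]%classic (v 0 i)].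
have K0 : 0 <= K by exact: sqrtr_ge0.
have box_y : box y by move=> i; rewrite /= in_itv /= gerBl lerDl K0.
have box_compact : compact box.
  apply: (@rV_compact _ _ (fun i => `[y 0 i - K, y 0 i + K]%classic)) => i.
  exact: segment_compact.
have [w /set_mem box_w w_min] := EVT_min_rV (ex_intro _ y box_y) box_compact
  (continuous_subspaceT (@prox_objective_continuous y)).
exists w => v; have [box_v|out] := pselect (box v).
  by apply: w_min; apply/mem_set.
apply: le_trans (w_min _ (mem_set box_y)) _.
have far : K <= enorm (v - y).
  rewrite leNgt; apply/negP => near; apply: out => i.
  have := le_lt_trans (coord_le_enorm (v - y) i) near.
  rewrite !mxE ltr_norml /= in_itv /= => /andP[].
  by move: (v 0 i) (y 0 i) => a b; lra.
rewrite prox_objective_center /prox_objective.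
have := s_min v; have : K ^+ 2 <= enorm (v - y) ^+ 2.
  by rewrite ler_pXn2r ?nnegrE ?enorm_ge0.
have gap0 : 0 <= 2 * (f y - f s) / rho.
  by rewrite divr_ge0 ?mulr_ge0 ?subr_ge0 ?s_min // ltW.
rewrite sqr_sqrtr // ler_pdivrMr // => h1 h2; vlra.
Qed.

(** With [f] itself as model the test always succeeds, so that no aggregation
    constraint ever arises. *)
Lemma execution_exists x0 : exists r, execution f rho beta x0 r.
Proof.
have [prox proxP] := choice prox_exists.
pose next (s : state R n) := let w := prox (yk s) in
  start (outer s).+1 w (zk s - aseq R (outer s) *: (yk s - w)).
pose r t := iter t next (start 0 x0 x0).
exists r; split=> // t.
have fresh : cand (r t) = yk (r t) /\ Defs.prev (r t) = None by case: t.
move: fresh; rewrite [r t.+1]/(next (r t)); move: (r t) => s [sc sp].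
apply: (DescentStep (m := f)) => //.
- by have [g gs] := f_subdiff (cand s); split; rewrite ?sp //; exists g.
- have := proxP (yk s) (yk s).
  rewrite prox_objective_center /prox_objective => le_f.
  rewrite /descent_test.
  have : f (prox (yk s)) <= f (yk s).
    by apply: le_trans le_f; rewrite lerDl mulr_ge0 ?sqr_ge0 // divr_ge0 // ltW.
  by rewrite -subr_ge0 => d0; rewrite ler_piMl // ltW.
Qed.

End Existence.

(** * The iteration count *)

(** Writing [L = (M + rho) / rho], the left side is at most
    [6 L^3 q / (1 - beta)]: the lower bound on [q] gives [L q >= 2], which
    absorbs the rounding of [q] to an integer. *)
Lemma count_bound (R : realType) (M rho beta q : R) :
  0 < M -> 0 < rho -> 0 < beta -> beta < 1 -> 0 <= q -> 4 * rho <= M * q ^+ 2 ->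
  (q + 1) * (4 * M * (M + rho) / (rho ^+ 2 * (1 - beta)) + 2) <=
  16 * (M + rho) ^+ 3 / ((1 - beta) ^+ 2 * rho ^+ 3) * q.
Proof.
move=> M0 rho0 beta0 beta1 q0 q_large.
pose L := (M + rho) / rho; pose v := (1 - beta)^-1.
have b0 : 0 < 1 - beta by rewrite subr_gt0.
have ME : M = (L - 1) * rho by rewrite /L; field; rewrite gt_eqF.
have L1 : 1 < L by rewrite -subr_gt0 -(pmulr_lgt0 _ rho0) -ME.
have v1 : 1 <= v by rewrite invf_ge1 //; lra.
have -> : 4 * M * (M + rho) / (rho ^+ 2 * (1 - beta)) = 4 * L * (L - 1) * v.
  by rewrite /L /v; field; rewrite !gt_eqF.
have -> : 16 * (M + rho) ^+ 3 / ((1 - beta) ^+ 2 * rho ^+ 3) =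
    16 * L ^+ 3 * v ^+ 2.
  by rewrite /L /v; field; rewrite !gt_eqF.
have {}q_large : 4 <= (L - 1) * q ^+ 2.
  by rewrite -(ler_pM2r rho0) mulrAC -ME.
clearbody L v.
have L0 : 0 < L by lra.
have Lq : 2 <= L * q.
  rewrite -(ler_pXn2r (n := 2)) ?nnegrE ?mulr_ge0 ?(ltW L0) // exprMn.
  have : (L - 1) * q ^+ 2 <= L ^+ 2 * q ^+ 2.
    by rewrite ler_wpM2r ?sqr_ge0 //; nra.
  lra.
have n_le : 4 * L * (L - 1) * v + 2 <= 4 * L ^+ 2 * v by nra.
have q_le : q + 1 <= 3 / 2 * L * q by nra.
have L3q : 0 <= L ^+ 3 * q by rewrite mulr_ge0 // exprn_ge0 // ltW.
have vv : 6 * v <= 16 * v ^+ 2 by nra.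
apply: (@le_trans _ _ (3 / 2 * L * q * (4 * L ^+ 2 * v))).
  apply: ler_pM => //; first by lra.
  by rewrite addr_ge0 // !mulr_ge0 //; lra.
have := ler_wpM2l L3q vv; lra.
Qed.

Theorem theorem1 (R : realType) (n : nat) (f : 'rV[R]_n -> R)
    (M c rho beta : R) (x0 : 'rV[R]_n)
    (f_convex : convex_fun f)
    (M_gt0 : 0 < M) (f_smooth : smooth M f)
    (S_neq0 : argmin f !=set0)
    (c_gt0 : 0 < c) (rho_ge : M / c <= rho)
    (beta_ge : (c + 2 * Num.sqrt c + 2) / (c + 2 * Num.sqrt c + 3) <= beta)
    (beta_lt1 : beta < 1) :
  (exists r : nat -> state R n, execution f rho beta x0 r) /\
  (forall r : nat -> state R n, execution f rho beta x0 r ->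
    [/\ (forall k : nat, exists t : nat, outer (r t) = k),
        (forall k t : nat, (1 <= k)%N -> outer (r t) = k ->
           f (xk (r t)) - minval f
             <= 2 * rho * dist x0 (argmin f) ^+ 2 / k%:R ^+ 2) &
        (forall eps : R, 0 < eps ->
           exists2 t : nat,
             t%:R <= 16 * (M + rho) ^+ 3 / ((1 - beta) ^+ 2 * rho ^+ 3)
                     * Num.sqrt (2 * rho * dist x0 (argmin f) ^+ 2 / eps)
             & f (xk (r t)) - minval f <= eps)]).
Proof.
have rho_gt0 : 0 < rho by apply: lt_le_trans rho_ge; rewrite divr_gt0.
have M_le : M <= c * rho by rewrite mulrC -ler_pdivrMr.
have q_ge0 : 0 <= Num.sqrt c := sqrtr_ge0 c.
have beta_large : (1 - beta) * (c + 2 * Num.sqrt c + 2) <= beta.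
  by move: beta_ge; rewrite ler_pdivrMr; lra.
have beta_gt0 : 0 < beta.
  by apply: lt_le_trans beta_ge; apply: divr_gt0; lra.
have f_upper := subdiff_upper f_smooth.
have f_subdiff x : exists g, subdiff f x g.
  by exists (grad f x); exact: (grad_subdiff f_convex f_smooth).
have f_cont : continuous f.
  by move=> x; apply: differentiable_continuous; case: f_smooth.
split; first exact: execution_exists.
move=> r r_exec; have [s s_min] := S_neq0.
set D := dist x0 (argmin f).
have rate_dist k t : (1 <= k)%N -> outer (r t) = k ->
    f (xk (r t)) - minval f <= 2 * rho * D ^+ 2 / k%:R ^+ 2.
  move=> k1 outer_t; rewrite mulrAC; apply: le_dist_sq => // [|u u_min].
    by rewrite divr_ge0 ?sqr_ge0 // mulr_ge0 // ltW.
  rewrite (minval_argmin u_min).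
  exact: (rate M_gt0 rho_gt0 beta_lt1 c_gt0 M_le beta_large f_upper f_subdiff
    r_exec).
have reached k :=
  outer_reached M_gt0 rho_gt0 beta_lt1 f_upper f_subdiff r_exec k.
split=> // [k|eps eps_gt0].
  by have [t _ [x [z rt]]] := reached k; exists t; rewrite rt.
have [eps_large|eps_small] := leP (M / 2 * D ^+ 2) eps.
  (* [x0] itself is [eps]-optimal: the gradient vanishes at a minimizer. *)
  exists 0%N; last first.
    apply: le_trans eps_large; have [-> _] := r_exec.
    apply: le_dist_sq => // [|u u_min]; first by rewrite divr_ge0 // ltW.
    rewrite (minval_argmin u_min) enormK lerBlDl.
    have u0 : subdiff f u 0 by move=> v; rewrite dot0l addr0; exact: u_min.
    by apply: le_trans (f_upper _ _ x0 u0) _; rewrite dot0l addr0.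
  rewrite mulr_ge0 ?sqrtr_ge0 // divr_ge0 // mulr_ge0 ?sqr_ge0 ?exprn_ge0 //;
    lra.
set q := Num.sqrt _.
have D2 : 2 * rho * D ^+ 2 = q ^+ 2 * eps.
  have rD0 : 0 <= 2 * rho * D ^+ 2.
    by rewrite mulr_ge0 ?sqr_ge0 // mulr_ge0 // ltW.
  by rewrite sqr_sqrtr ?divfK ?gt_eqF // divr_ge0 // ltW.
have q0 : 0 <= q by exact: sqrtr_ge0.
have q_large : 4 * rho <= M * q ^+ 2.
  rewrite -(ler_pM2r eps_gt0) -mulrA -(mulrA M) -D2.
  have := ler_wpM2l (ltW rho_gt0) (ltW eps_small); lra.
have [t tk [x [z rt]]] := reached (Num.truncn q).+1.
exists t; last first.
  apply: le_trans (rate_dist (Num.truncn q).+1 t isT _) _; first by rewrite rt.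
  rewrite D2 ler_pdivrMr ?exprn_gt0 ?ltr0n // mulrC ler_pM2l //.
  by rewrite ler_pXn2r ?nnegrE ?ler0n // ltW // truncnS_gt.
apply: le_trans (count_bound M_gt0 rho_gt0 beta_gt0 beta_lt1 q0 q_large).
have B0 : 0 <= 4 * M * (M + rho) / (rho ^+ 2 * (1 - beta)).
  by rewrite divr_ge0 // !mulr_ge0 ?sqr_ge0 //; lra.
have : t%:R <= ((Num.truncn q).+1 * call_length M rho beta)%:R :> R.
  by rewrite ler_nat.
move=> /le_trans; apply; rewrite natrM; apply: ler_pM => //.
  by rewrite -natr1 lerD2r truncn_le.
by rewrite /call_length -addn2 natrD lerD2r truncn_le.
Qed.
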